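(* Let $(\tau_n)_{n\ge 1}$ be a Markov chain with values in $\{0,1\}$, with initial probabilities $p_0>0$, $p_1>0$ ($p_0+p_1=1$) and with transition matrix $\begin{pmatrix} p_{00} & p_{01}\\ p_{10} & p_{11}\end{pmatrix}$, and let $\tau=\Delta^{G_2}_{\tau_1\tau_2\ldots\tau_n\ldots}$. Suppose that exactly one of the four entries of the transition matrix is zero, and let $i\in\{0,1\}$. Then: 1) if $p_{[1-i]i}=0$, then $\tau$ has a pure discrete distribution, with countable point spectrum $$D_\tau=\{\Delta^{G_2}_{(1-i)}\}\cup\{\Delta^{G_2}_{\underbrace{\scriptstyle ii\ldots i}_{k}(1-i)} : k\in\mathbb{N}\};$$ 2) if $p_{[1-i][1-i]}=0$, then $\tau$ has a singularly continuous distribution of Cantor type whose spectrum is the self-similar fractal set $$S_\tau=\{x=\Delta^{G_2}_{\alpha_1\alpha_2\ldots\alpha_n\ldots} : (\alpha_k,\alpha_{k+1})\neq(1-i,1-i)\ \text{ for all } k\in\mathbb{N}\},$$ and the Hausdorff--Besicovitch dimension of $S_\tau$ is the solution $x$ of the equation $$|g_i|^x+|g_0g_1|^x=1.$$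
   Context: Fix a real number $g_0\in[\frac12,1)$ and put $g_1=g_0-1$, $\delta_0=0$, $\delta_1=g_0$. For a sequence $(\alpha_n)_{n\ge1}$ of elements of $\{0,1\}$ put $$\Delta^{G_2}_{\alpha_1\alpha_2\ldots\alpha_n\ldots}=\delta_{\alpha_1}+\sum_{k=2}^\infty \delta_{\alpha_k}\prod_{j=1}^{k-1}g_{\alpha_j}\in[0,g_0].$$ Every $x\in[0,g_0]$ equals $\Delta^{G_2}_{\alpha_1\alpha_2\ldots}$ for some sequence of zeros and ones (a $G_2$-representation of $x$). Parentheses in a digit string denote a period (an infinitely repeated block). $\mathbb{N}=\{1,2,3,\ldots\}$. The symbol $p_{ab}$ denotes the transition probability $P\{\tau_{n+1}=b\mid\tau_n=a\}$ (rows of the matrix sum to $1$); $[1-i]$ denotes the digit $1-i$. The point spectrum $D_\tau$ is the set of atoms of the distribution of $\tau$. The spectrum $S_\tau$ is the minimal closed support of the distribution (the set of growth points of the distribution function). A distribution is pure discrete if it is concentrated on an at most countable set; it is singularly continuous if it has no atoms and is concentrated on a set of zero Lebesgue measure; it is of Cantor type if its spectrum has zero Lebesgue measure. Here self-similarity of $S_\tau$ means that $S_\tau$ is the union of its parts consisting of numbers with representations beginning with $i$ and with $[1-i]i$ respectively, which are similar to $S_\tau$ with ratios $|g_i|$ and $|g_0g_1|$. A set is called fractal if its Hausdorff--Besicovitch dimension is fractional. *)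

(* Defs.v *)
From HB Require Import structures.
From mathcomp Require Import all_boot all_order all_algebra.
From mathcomp Require Import all_classical all_reals all_analysis.
From mathcomp Require Import measurable_realfun lra.

Set Implicit Arguments.
Unset Strict Implicit.
Unset Printing Implicit Defensive.

Import Order.TTheory GRing.Theory Num.Theory.
Import numFieldNormedType.Exports.

Local Open Scope classical_set_scope.
Local Open Scope ring_scope.

(* Digits are booleans ([false] is 0, [true] is 1, [~~ i] is 1 - i), and    *)
(* sequences indexed by 1, 2, 3, ... are indexed here from 0: [a n] is the   *)
(* (n+1)-st term.                                                            *)

Definition g (R : realType) (g0 : R) (b : bool) : R := if b then g0 - 1 else g0.

Definition delta (R : realType) (g0 : R) (b : bool) : R := if b then g0 else 0.

Definition G2 (R : realType) (g0 : R) (a : nat -> bool) : R :=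
  delta g0 (a 0%N)
  + limn (fun n => \sum_(1 <= k < n)
            (delta g0 (a k) * \prod_(0 <= j < k) g g0 (a j))).

(* The digit string i i ... i (1-i) (1-i) (1-i) ... with k leading digits i. *)
Definition run_then (k : nat) (i : bool) : nat -> bool :=
  fun n => if (n < k)%N then i else ~~ i.

Lemma g_le (R : realType) (g0 : R) b : 2^-1 <= g0 < 1 -> `|g g0 b| <= g0.
Proof.
move=> /andP[g0ge g0lt]; rewrite ler_norml.
by case: b => /=; apply/andP; split; lra.
Qed.

Lemma is_cvg_G2 (R : realType) (g0 : R) (a : nat -> bool) : 2^-1 <= g0 < 1 ->
  cvgn (fun n => \sum_(1 <= k < n)
    (delta g0 (a k) * \prod_(0 <= j < k) g g0 (a j))).
Proof.
move=> hg0; have [g0ge g0lt] := andP hg0.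
have g0_gt0 : 0 < g0 by exact: lt_le_trans g0ge.
set u := fun k => delta g0 (a k) * \prod_(0 <= j < k) g g0 (a j).
have -> := is_cvg_series_restrict 1 u.
apply: normed_cvg; apply: (@series_le_cvg _ _ (geometric 1 g0)).
- by move=> n; exact: normr_ge0.
- by move=> n; rewrite /geometric/= mul1r exprn_ge0// ltW.
- move=> n /=; rewrite mul1r /u normrM normr_prod -[leRHS]mul1r.
  apply: ler_pM => //; first by rewrite prodr_ge0.
    by rewrite /delta; case: (a n); rewrite ?normr0// gtr0_norm// ltW.
  rewrite big_mkord (le_trans (_ : _ <= \prod_(j < n) g0))//.
    by apply: ler_prod => j _; rewrite normr_ge0 g_le.
  by rewrite prodr_const card_ord.
- by apply: is_cvg_geometric_series; rewrite gtr0_norm.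
Qed.

(* The number with random digits X 0, X 1, ... is a random variable. *)
Lemma measurable_G2 (R : realType) (g0 : R) (d : measure_display)
    (Omega : measurableType d) (X : nat -> {mfun Omega >-> bool}) :
  2^-1 <= g0 < 1 -> measurable_fun setT (fun w => G2 g0 (fun n => X n w)).
Proof.
move=> hg0.
have mf (f : bool -> R) n : measurable_fun setT (fun w => f (X n w)).
  by apply: (measurableT_comp (f := f)).
apply: measurable_funD; first exact: mf.
apply: (measurable_fun_cvg (h := fun n w => \sum_(1 <= k < n)
    (delta g0 (X k w) * \prod_(0 <= j < k) g g0 (X j w)))).
  move=> m; apply: measurable_sum => k; apply: measurable_funM; first exact: mf.
  by apply: measurable_prod => j _; exact: mf.
by move=> w _; exact: (is_cvg_G2 hg0).
Qed.

(* Meaningful only when [P B > 0]. *)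
Definition cond_prob (d : measure_display) (Omega : measurableType d)
    (R : realType) (P : probability Omega R) (A B : set Omega) : R :=
  fine (P (A `&` B)) / fine (P B).

Definition stochastic (R : realType) (p : bool -> R) (q : bool -> bool -> R) :=
  [/\ forall a, 0 <= p a, p false + p true = 1,
      forall a b, 0 <= q a b & forall a, q a false + q a true = 1].

Definition markov_chain (d : measure_display) (Omega : measurableType d)
    (R : realType) (P : probability Omega R) (X : nat -> {RV P >-> bool})
    (p : bool -> R) (q : bool -> bool -> R) :=
  [/\ stochastic p q,
      forall a, P [set w | X 0%N w = a] = (p a)%:E &
      forall (n : nat) (a : nat -> bool) (b : bool),
        let past := [set w | forall k, (k <= n)%N -> X k w = a k] in
        (0 < P past)%E ->
        cond_prob P [set w | X n.+1 w = b] past = q (a n) b].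
Arguments markov_chain {d Omega R} P X p q.

Definition concentrated_on (R : realType) (mu : set R -> \bar R) (A : set R) :=
  mu (~` A) = 0%E.

Definition point_spectrum (R : realType) (mu : set R -> \bar R) : set R :=
  [set x | (0 < mu [set x])%E].

(* The minimal closed support. *)
Definition spectrum (R : realType) (mu : set R -> \bar R) : set R :=
  \bigcap_(C in [set C | closed C /\ concentrated_on mu C]) C.

Definition pure_discrete (R : realType) (mu : set R -> \bar R) :=
  exists2 A : set R, countable A & concentrated_on mu A.

Definition singularly_continuous (R : realType) (mu : set R -> \bar R) :=
  point_spectrum mu = set0 /\
  exists A : set R, [/\ measurable A, lebesgue_measure A = 0%E &
    concentrated_on mu A].

Definition cantor_type (R : realType) (mu : set R -> \bar R) :=
  lebesgue_measure (spectrum mu) = 0%E.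

Definition diam (R : realType) (A : set R) : \bar R :=
  ereal_sup [set `|z.1 - z.2|%:E | z in A `*` A].

(* The empty set contributes 0 for every s, also for s = 0. *)
Definition diam_pow (R : realType) (s : R) (A : set R) : \bar R :=
  if A == set0 then 0%E else (diam A `^ s)%E.

Definition hausdorff_premeasure (R : realType) (s e : R) (A : set R) : \bar R :=
  ereal_inf [set (\sum_(0 <= n <oo) diam_pow s (U n))%E |
    U in [set U : nat -> set R |
      A `<=` \bigcup_n U n /\ forall n, (diam (U n) <= e%:E)%E]].

Definition hausdorff_measure (R : realType) (s : R) (A : set R) : \bar R :=
  ereal_sup [set hausdorff_premeasure s e A | e in [set e : R | 0 < e]].

Definition hausdorff_dim (R : realType) (A : set R) : \bar R :=
  ereal_inf [set s%:E | s in [set s : R | 0 <= s /\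
    hausdorff_measure s A = 0%E]].

Definition fractal (R : realType) (A : set R) :=
  exists2 s : R, hausdorff_dim A = s%:E & s \isn't a Num.int.

Definition similar_with_ratio (R : realType) (r : R) (A B : set R) :=
  exists2 f : R -> R, f @` A = B &
    forall x y, A x -> A y -> `|f x - f y| = r * `|x - y|.

(* The part of S formed by the numbers having a representation that begins *)
(* with the digit string w.                                                *)
Definition part (R : realType) (g0 : R) (S : set R) (w : seq bool) : set R :=
  S `&` [set G2 g0 a | a in [set a | mkseq a (size w) = w]].

Definition self_similar (R : realType) (g0 : R) (i : bool) (S : set R) :=
  [/\ S = part g0 S [:: i] `|` part g0 S [:: ~~ i; i],
      similar_with_ratio `|g g0 i| S (part g0 S [:: i]) &
      similar_with_ratio `|g g0 false * g g0 true| S (part g0 S [:: ~~ i; i])].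

(* Main.v *)
Require Import Defs.
From HB Require Import structures.
From mathcomp Require Import all_boot all_order all_algebra.
From mathcomp Require Import all_classical all_reals all_analysis.
From mathcomp Require Import measurable_realfun lra.

Set Implicit Arguments.
Unset Strict Implicit.
Unset Printing Implicit Defensive.

Import Order.TTheory GRing.Theory Num.Theory.
Import numFieldNormedType.Exports.

Local Open Scope classical_set_scope.
Local Open Scope ring_scope.

(** Prepending a digit [b] to an expansion applies the affine map [prepend b] of
    ratio [g g0 b] to its value ([G2_rec]). The two maps send the interval from
    0 to [g0] onto two intervals that share only the point [g0 ^+ 2].

    If [~~ i] is absorbing, then almost surely the digits are a finite run of
    [i] followed by [~~ i] forever. These sequences are countably many and each
    has positive probability, so their values, which are pairwise distinct
    ([G2_run_then_inj]), are exactly the atoms.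

    If [~~ i] is never repeated, then almost surely the digits form an
    admissible sequence. The set S of values of admissible sequences is the
    union of its images under [prepend i] and [prepend (~~ i) \o prepend i], and
    these images lie at a positive distance from each other ([G2_gap]). Hence
    the expansion is injective on admissible sequences ([G2_inj]). An admissible
    path visits [i] at least every second step and the transitions from [i] have
    probability less than 1, so every single path has probability 0
    ([admissible_path_negligible]) and there are no atoms. The set S is compact,
    and each cylinder of admissible sequences has positive probability, so S is
    the spectrum.

    The dimension of S is found without a measure on S. Let [x] be the
    exponent at which the [x]-th powers of the two ratios sum to 1, and let
    [d] be a lower bound for the distance between the two images of S. Any
    finite cover of S by sets of diameters at most [l j] satisfies [d `^ x <=
    \sum_j l j `^ x] ([finite_cover_sum_ge]). Indeed, either some [l j] is at
    least [d], or the cover splits into separate covers of the two images,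
    each pulled back to a smaller cover of S; induction on the number of sets
    concludes. Compactness extends the bound to countable covers, up to an
    arbitrarily small error. The upper bound comes from the covers by the
    iterated images, whose [s]-th powers of diameters sum to a geometric
    sequence of ratio less than 1 for [s > x]. Since the two ratios sum to
    less than 1, the same covers with [s = 1] show that S is Lebesgue-null,
    and [x] lies strictly between 0 and 1, hence is not an integer. *)

(** * The expansion as an iteration of two affine maps *)

Section G2_maps.
Variables (R : realType) (g0 : R).
Hypothesis hg0 : 2^-1 <= g0 < 1.

(** The map that puts the digit [b] in front of the expansion of [x]. *)
Definition prepend (b : bool) (x : R) : R := delta g0 b + g g0 b * x.

(** The sequence without its first digit. *)
Definition shift (a : nat -> bool) : nat -> bool := fun n => a n.+1.

(** The sum of the first [n] terms of the expansion; its first term, which the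
    definition of [G2] singles out, is the one of index 0, with an empty
    product. *)
Definition G2_partial (a : nat -> bool) (n : nat) : R :=
  \sum_(0 <= k < n) (delta g0 (a k) * \prod_(0 <= j < k) g g0 (a j)).

Lemma g0_gt0 : 0 < g0. Proof. by have /andP[] := hg0; lra. Qed.

Lemma g0_lt1 : g0 < 1. Proof. by have /andP[] := hg0. Qed.

Lemma normg_gt0 b : 0 < `|g g0 b|.
Proof. by have /andP[h1 h2] := hg0; rewrite normr_gt0; case: b => /=; lra. Qed.

Lemma normg_lt1 b : `|g g0 b| < 1.
Proof. exact: le_lt_trans (g_le b hg0) g0_lt1. Qed.

Lemma normg_true : `|g g0 true| = 1 - g0.
Proof. by rewrite /g/= ler0_norm; [lra|have := g0_lt1; lra]. Qed.

Lemma normg_false : `|g g0 false| = g0.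
Proof. by rewrite /g/= gtr0_norm// g0_gt0. Qed.

Lemma prepend_dist b x y :
  `|prepend b x - prepend b y| = `|g g0 b| * `|x - y|.
Proof. by rewrite /prepend opprD addrACA subrr add0r -mulrBr normrM. Qed.

Lemma cvg_G2_partial a : G2_partial a n.+1 @[n --> \oo] --> G2 g0 a.
Proof.
have -> : (fun n => G2_partial a n.+1) = (fun n => delta g0 (a 0%N) +
    \sum_(1 <= k < n.+1) (delta g0 (a k) * \prod_(0 <= j < k) g g0 (a j))).
  apply/funext => n; rewrite /G2_partial big_ltn//.
  by rewrite [X in _ * X + _ = _]big_geq// mulr1.
apply: cvgD; first exact: cvg_cst.
have := @is_cvg_G2 R g0 a hg0.
by rewrite -(cvg_shiftS (fun n =>
  \sum_(1 <= k < n) (delta g0 (a k) * \prod_(0 <= j < k) g g0 (a j)))).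
Qed.

Lemma G2_partialS a n :
  G2_partial a n.+1 = prepend (a 0%N) (G2_partial (shift a) n).
Proof.
rewrite /G2_partial big_nat_recl// big_geq// mulr1 /prepend mulr_sumr.
congr (_ + _); apply: eq_bigr => k _.
by rewrite big_nat_recl// mulrCA.
Qed.

(** Every later fact on [G2] comes from this recursion. *)
Lemma G2_rec a : G2 g0 a = prepend (a 0%N) (G2 g0 (shift a)).
Proof.
have h : G2_partial a n.+2 @[n --> \oo] --> G2 g0 a.
  by rewrite (cvg_shiftS (fun n => G2_partial a n.+1)); exact: cvg_G2_partial.
apply: (@cvg_unique _ (@Rhausdorff R) _ _ _ _ h).
rewrite [X in X @ _](_ : _ = fun n =>
    prepend (a 0%N) (G2_partial (shift a) n.+1)); last first.
  by apply/funext => n; rewrite G2_partialS.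
apply: cvgD; first exact: cvg_cst.
by apply: cvgMl_tmp; exact: cvg_G2_partial.
Qed.

Lemma prepend_itv b x : 0 <= x <= g0 -> 0 <= prepend b x <= g0.
Proof.
move=> /andP[x0 x1]; have h0 := g0_gt0; have h1 := g0_lt1.
by rewrite /prepend /delta /g; case: b => /=; apply/andP; split; nra.
Qed.

Lemma G2_itv a : 0 <= G2 g0 a <= g0.
Proof.
have h n b : 0 <= G2_partial b n <= g0.
  elim: n b => [|n IHn] b.
    by rewrite /G2_partial big_geq// lexx ltW// g0_gt0.
  by rewrite G2_partialS prepend_itv.
have c := @cvg_G2_partial a.
have /cvg_lim <- // := c.
apply/andP; split; [apply: limr_ge|apply: limr_le].
- by apply/cvg_ex; eexists; exact: c.
- by apply: nearW => n; have /andP[] := h n.+1 a.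
- by apply/cvg_ex; eexists; exact: c.
- by apply: nearW => n; have /andP[] := h n.+1 a.
Qed.

Lemma G2_close n a b : (forall k, (k < n)%N -> a k = b k) ->
  `|G2 g0 a - G2 g0 b| <= g0 ^+ n.
Proof.
elim: n a b => [|n IHn] a b ab.
  have /andP[a0 a1] := G2_itv a; have /andP[b0 b1] := G2_itv b.
  have h1 := g0_lt1; rewrite expr0 ler_norml; apply/andP; split; lra.
rewrite (G2_rec a) (G2_rec b) ab// prepend_dist exprS.
by apply: ler_pM => //; [exact: g_le|apply: IHn => k kn; rewrite /shift ab].
Qed.

Lemma G2_cst_cst b : G2 g0 (fun=> b) = prepend b (G2 g0 (fun=> b)).
Proof. by rewrite {1}G2_rec. Qed.

Lemma G2_run_thenS k i :
  G2 g0 (run_then k.+1 i) = prepend i (G2 g0 (run_then k i)).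
Proof. by rewrite G2_rec. Qed.

(** The fixed point of [prepend i] is the number with all digits [i]; the k-th
    value lies at a distance from it proportional to the k-th power of
    [`|g g0 i|]. *)
Lemma G2_run_then_inj i : injective (fun k => G2 g0 (run_then k i)).
Proof.
have dist k : `|G2 g0 (run_then k i) - G2 g0 (fun=> i)| =
    `|g g0 i| ^+ k * `|G2 g0 (fun=> ~~ i) - G2 g0 (fun=> i)|.
  elim: k => [|k IHk]; first by rewrite expr0 mul1r.
  by rewrite G2_run_thenS {1}(G2_cst_cst i) prepend_dist IHk exprS mulrA.
have ne0 : `|G2 g0 (fun=> ~~ i) - G2 g0 (fun=> i)| != 0.
  rewrite normr_eq0; apply/eqP => e.
  have := G2_cst_cst i; have := G2_cst_cst (~~ i).
  have -> : G2 g0 (fun=> ~~ i) = G2 g0 (fun=> i).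
    by apply/eqP; rewrite -subr_eq0 e.
  have h0 := g0_gt0; have h1 := g0_lt1.
  rewrite /prepend /delta /g; case: i {e dist} => /=; set x := G2 _ _ => e1 e2.
    have xg0 : x = g0 by lra.
    rewrite xg0 in e1; by nra.
  have xg0 : x = g0 by lra.
  by rewrite xg0 in e2; nra.
move=> j k /= jk; have := dist j; rewrite jk dist => /(mulIf ne0).
move=> /(ieexprIn (normg_gt0 i)) -> //.
by rewrite lt_eqF// normg_lt1.
Qed.

End G2_maps.

(** * Numbers with an admissible expansion *)

(** The digit sequences in which [~~ i] never occurs twice in a row. *)
Definition admissible (i : bool) : set (nat -> bool) :=
  [set a | forall k, (a k, a k.+1) <> (~~ i, ~~ i)].

(** The set of the numbers that have an admissible expansion. *)
Definition admissible_values (R : realType) (g0 : R) (i : bool) : set R :=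
  [set G2 g0 a | a in admissible i].

Lemma admissible_shift i a : admissible i a -> admissible i (shift a).
Proof. by move=> h k; exact: h. Qed.

Lemma admissible_step i a k : admissible i a -> a k = i \/ a k.+1 = i.
Proof.
by move=> /(_ k); case: (a k) (a k.+1) i => -[] [] //=; tauto.
Qed.

(** The sequence [a] preceded by the digit [b]. *)
Definition cons_digit (b : bool) (a : nat -> bool) : nat -> bool :=
  fun n => if n is m.+1 then a m else b.

Lemma admissible_cons_digit i a :
  admissible i a -> admissible i (cons_digit i a).
Proof. by move=> h [|k] /=; [case: (i) => -[]//|exact: h]. Qed.

Lemma admissible_cons_digit2 i a :
  admissible i a -> admissible i (cons_digit (~~ i) (cons_digit i a)).
Proof.
by move=> h [|k] /=; [case: (i) => -[]//|exact: admissible_cons_digit].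
Qed.

Section admissible_values.
Variables (R : realType) (g0 : R).
Hypothesis hg0 : 2^-1 <= g0 < 1.
Let g0gt0 : 0 < g0. Proof. exact: g0_gt0. Qed.
Let g0lt1 : g0 < 1. Proof. exact: g0_lt1. Qed.

Lemma G2_first0 a : a 0%N = false -> 0 <= G2 g0 a <= g0 ^+ 2.
Proof.
have [gt0 lt1] := (g0gt0, g0lt1).
move=> a0; rewrite (G2_rec hg0) a0 /prepend/=.
have /andP[x0 x1] := G2_itv hg0 (shift a).
move: (G2 _ _) x0 x1 => x x0 x1.
by rewrite add0r expr2 mulr_ge0 ?ler_pM2l// ltW.
Qed.

Lemma G2_first1 a : a 0%N = true -> g0 ^+ 2 <= G2 g0 a <= g0.
Proof.
have [gt0 lt1] := (g0gt0, g0lt1).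
move=> a0; rewrite (G2_rec hg0) a0 /prepend/=.
have /andP[x0 x1] := G2_itv hg0 (shift a).
move: (G2 _ _) x0 x1 => x x0 x1.
have h1 : 0 <= (1 - g0) * (g0 - x) by apply: mulr_ge0; lra.
have h2 : 0 <= (1 - g0) * x by apply: mulr_ge0; lra.
by apply/andP; split; lra.
Qed.

Lemma admissible1_ge a : admissible true a -> g0 ^+ 3 <= G2 g0 a.
Proof.
move=> adm; case a0 : (a 0%N).
  have /andP[x0 _] := G2_first1 a0; apply: le_trans x0.
  by rewrite [leLHS]exprS ler_piMl ?sqr_ge0 ?ltW.
have [|a1] := admissible_step 0 adm; first by rewrite a0.
rewrite (G2_rec hg0) a0 /prepend/= add0r.
have /andP[+ _] := @G2_first1 (shift a) a1; set x := G2 _ _ => x0.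
by rewrite exprS ler_pM2l.
Qed.

Lemma admissible1_le a :
  admissible true a -> G2 g0 a <= g0 - (1 - g0) * g0 ^+ 3.
Proof.
have [gt0 lt1] := (g0gt0, g0lt1).
move=> adm; have g3 : g0 ^+ 3 <= g0.
  by rewrite exprS ler_piMr ?exprn_ile1 ?ltW.
case a0 : (a 0%N).
  rewrite (G2_rec hg0) a0 /prepend/=.
  have := admissible1_ge (admissible_shift adm); set x := G2 _ _ => x0.
  by nra.
have /andP[_ h] := G2_first0 a0; apply: le_trans h _.
by nra.
Qed.

(** Two strings whose first digits differ have values far apart, as soon as one
    is admissible and the other does not begin with the forbidden block. The
    images of the interval from 0 to [g0] under the two maps [prepend b] share
    only the point [g0 ^+ 2], and admissibility keeps one of the two values
    away from it. *)
Lemma G2_gap i a b : admissible i a -> b 0%N = i \/ b 1%N = i ->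
  a 0%N <> b 0%N -> (1 - g0) ^+ 2 * g0 ^+ 3 <= `|G2 g0 a - G2 g0 b|.
Proof.
have [gt0 lt1] := (g0gt0, g0lt1).
move=> adma bi ab; have adm0 := admissible_step 0 adma.
have g012 : 1 - g0 <= g0 by have /andP[] := hg0; lra.
have g3ge0 : 0 <= g0 ^+ 3 by rewrite exprn_ge0// ltW.
have g3 : g0 ^+ 3 <= g0.
  by rewrite exprS ler_piMr ?exprn_ile1 ?ltW.
have gap0 c e : c 0%N = true -> c 1%N = false -> e 0%N = false ->
    (1 - g0) ^+ 2 * g0 ^+ 3 <= G2 g0 c - G2 g0 e.
  move=> c0 c1 e0; have /andP[_ he] := G2_first0 e0.
  have /andP[_ hc] := @G2_first0 (shift c) c1.
  rewrite (G2_rec hg0 c) c0 /prepend/=.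
  apply: (@le_trans _ _ ((1 - g0) ^+ 2 * g0)).
    by rewrite ler_wpM2l// sqr_ge0.
  by nra.
case: i adma bi adm0 => adma bi adm0.
  case a0: (a 0%N) ab => ab; case b0 : (b 0%N) ab => // _.
    have /andP[_ hb] := G2_first0 b0.
    have := admissible1_le (admissible_shift adma).
    rewrite (G2_rec hg0 a) a0 /prepend/=; set x := G2 _ (shift a) => hx.
    apply: le_trans (ler_norm _).
    have : (1 - g0) * x <= (1 - g0) * (g0 - (1 - g0) * g0 ^+ 3).
      by rewrite ler_wpM2l// subr_ge0 ltW.
    by nra.
  have /andP[hb _] := G2_first1 b0.
  have := admissible1_le (admissible_shift adma).
  rewrite (G2_rec hg0 a) a0 /prepend/=; set x := G2 _ (shift a) => hx.
  rewrite distrC; apply: le_trans (ler_norm _).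
  have : g0 * x <= g0 * (g0 - (1 - g0) * g0 ^+ 3) by rewrite ler_wpM2l// ltW.
  have : (1 - g0) * ((1 - g0) * g0 ^+ 3) <= g0 * ((1 - g0) * g0 ^+ 3).
    by rewrite ler_wpM2r// mulr_ge0// subr_ge0 ltW.
  by nra.
case a0: (a 0%N) ab adm0 => ab adm0; case b0 : (b 0%N) ab bi => // _ bi.
  case: adm0 => // a1.
  by apply: le_trans (gap0 _ _ _ _ _) (ler_norm _).
case: bi => // b1; rewrite distrC.
by apply: le_trans (gap0 _ _ _ _ _) (ler_norm _).
Qed.

Lemma gap_gt0 : 0 < (1 - g0) ^+ 2 * g0 ^+ 3.
Proof. by rewrite mulr_gt0// exprn_gt0// subr_gt0. Qed.

Lemma G2_first_digit i a b : admissible i a -> b 0%N = i \/ b 1%N = i ->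
  G2 g0 a = G2 g0 b -> a 0%N = b 0%N.
Proof.
move=> adma bi e; apply/eqP/negPn/negP => /eqP ab.
have := G2_gap adma bi ab; rewrite e subrr normr0.
by have := gap_gt0; lra.
Qed.

Lemma prepend_inj b : injective (@prepend R g0 b).
Proof.
move=> x y xy; have := prepend_dist g0 b x y; rewrite xy subrr normr0.
move=> /esym/eqP; rewrite mulf_eq0 !normr_eq0 -normr_eq0.
by rewrite gt_eqF ?normg_gt0//= subr_eq0 => /eqP.
Qed.

Lemma G2_inj i : {in admissible i &, injective (G2 g0)}.
Proof.
move=> a b /set_mem adma /set_mem admb ab; apply/funext => n.
elim: n a b adma admb ab => [|n IHn] a b adma admb ab;
  have ab0 := G2_first_digit adma (admissible_step 0 admb) ab; first by [].
apply: (IHn (shift a) (shift b)); try exact: admissible_shift.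
by move: ab; rewrite (G2_rec hg0 a) (G2_rec hg0 b) ab0 => /prepend_inj.
Qed.

Lemma admissible_values_rec i (S := admissible_values g0 i) :
  S = prepend g0 i @` S `|` (prepend g0 (~~ i) \o prepend g0 i) @` S.
Proof.
apply/seteqP; split => x.
  move=> [a adma <-]; have [a0|a0] := eqVneq (a 0%N) i.
    left; exists (G2 g0 (shift a)); last by rewrite (G2_rec hg0 a) a0.
    by exists (shift a) => //; exact: admissible_shift.
  have {}a0 : a 0%N = ~~ i by move: a0; case: (a 0%N) (i) => -[].
  have [|a1] := admissible_step 0 adma; first by rewrite a0; case: (i).
  right; exists (G2 g0 (shift (shift a))).
    by exists (shift (shift a)) => //; do 2 apply: admissible_shift.
  by rewrite (G2_rec hg0 a) (G2_rec hg0 (shift a)) a0 /shift a1.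
move=> [|] [_ [a adma <-] <-].
  exists (cons_digit i a); first exact: admissible_cons_digit.
  by rewrite (G2_rec hg0).
exists (cons_digit (~~ i) (cons_digit i a)).
  exact: admissible_cons_digit2.
by rewrite (G2_rec hg0) (G2_rec hg0 (shift _)).
Qed.

(** A part is defined through arbitrary representations; the gap shows that
    no other number of the set enters it through a forbidden one. *)
Lemma part_digitE i (S := admissible_values g0 i) :
  part g0 S [:: i] = prepend g0 i @` S.
Proof.
apply/seteqP; split => x.
  move=> [[a adma <-] [b /= [b0] ba]].
  have a0 : a 0%N = i.
    by rewrite (G2_first_digit adma (or_introl b0) (esym ba)).
  exists (G2 g0 (shift a)); last by rewrite (G2_rec hg0 a) a0.
  by exists (shift a) => //; exact: admissible_shift.
move=> [_ [a adma <-] <-]; split.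
  by rewrite [S]admissible_values_rec; left; exists (G2 g0 a) => //; exists a.
by exists (cons_digit i a) => //; rewrite (G2_rec hg0).
Qed.

Lemma part_blockE i (S := admissible_values g0 i) :
  part g0 S [:: ~~ i; i] = (prepend g0 (~~ i) \o prepend g0 i) @` S.
Proof.
apply/seteqP; split => x.
  move=> [[a adma <-] [b /= [b0 b1] ba]].
  have a0 : a 0%N = ~~ i.
    by rewrite (G2_first_digit adma (or_intror b1) (esym ba)).
  have [|a1] := admissible_step 0 adma; first by rewrite a0; case: (i).
  exists (G2 g0 (shift (shift a))).
    by exists (shift (shift a)) => //; do 2 apply: admissible_shift.
  by rewrite (G2_rec hg0 a) (G2_rec hg0 (shift a)) a0 /shift a1.
move=> [_ [a adma <-] <-]; split.
  by rewrite [S]admissible_values_rec; right; exists (G2 g0 a) => //; exists a.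
exists (cons_digit (~~ i) (cons_digit i a)) => //.
by rewrite (G2_rec hg0) (G2_rec hg0 (shift _)).
Qed.

Lemma prepend2_dist i x y :
  `|(prepend g0 (~~ i) \o prepend g0 i) x
    - (prepend g0 (~~ i) \o prepend g0 i) y| =
  `|g g0 false * g g0 true| * `|x - y|.
Proof.
rewrite /= !prepend_dist mulrA normrM; case: (i) => //=.
by rewrite [X in X * _]mulrC.
Qed.

Lemma self_similar_admissible_values i :
  self_similar g0 i (admissible_values g0 i).
Proof.
split.
- by rewrite part_digitE part_blockE -admissible_values_rec.
- exists (prepend g0 i); first by rewrite part_digitE.
  by move=> x y _ _; exact: prepend_dist.
- exists (prepend g0 (~~ i) \o prepend g0 i); first by rewrite part_blockE.
  by move=> x y _ _; exact: prepend2_dist.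
Qed.

Lemma nbhs_cantor_agree (a : cantor_space) n :
  nbhs a [set b : cantor_space | forall k, (k < n)%N -> b k = a k].
Proof.
elim: n => [|n IHn]; first by apply: filterS filterT => b _ k; rewrite ltn0.
have h : nbhs a [set b : cantor_space | b n = a n].
  have /(_ [set a n]) := @proj_continuous nat (fun=> bool) n a.
  by apply; rewrite nbhs_principalE; exact/principal_filterP.
apply: filterS (filterI IHn h) => b [/= bk bn] k.
by rewrite ltnS leq_eqVlt => /orP[/eqP ->//|]; exact: bk.
Qed.

(** Sequences agreeing on a long prefix have close values, so compactness of
    the space of digit sequences passes to the set of values. *)
Lemma G2_continuous : continuous (G2 g0 : cantor_space -> R).
Proof.
move=> a; apply/cvgrPdist_le => /= e e0.
have : (fun n => g0 ^+ n) @ \oo --> (0 : R).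
  by apply: cvg_expr; rewrite gtr0_norm.
move=> /cvgr0_norm_le /(_ _ e0) [n _ hn].
have := nbhs_cantor_agree a n; apply: filterS => b ab.
apply: le_trans (G2_close hg0 _) _; first by move=> k /ab.
have := hn n (leqnn n); apply: le_trans; exact: ler_norm.
Qed.

Lemma compact_admissible_values i : compact (admissible_values g0 i).
Proof.
apply: (@continuous_compact cantor_space R (G2 g0)).
  by apply: continuous_subspaceT; exact: G2_continuous.
apply: (@subclosed_compact _ _ [set: cantor_space]) => //; last first.
  exact: cantor_space_compact.
move=> a cla k; have [b [admb ab]] := cla _ (nbhs_cantor_agree a k.+2).
by rewrite -!ab//; exact: admb.
Qed.

End admissible_values.

(** * Hausdorff dimension of separated self-similar sets of reals *)

Section diameter.
Variable R : realType.
Implicit Types (A : set R) (l s x : R).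

Lemma diam_set0 : diam (set0 : set R) = -oo%E.
Proof. by rewrite /diam set0X image_set0 ereal_sup0. Qed.

Lemma diam_ge A u v : A u -> A v -> (`|u - v|%:E <= diam A)%E.
Proof. by move=> Au Av; apply: ereal_sup_ubound; exists (u, v). Qed.

Lemma diam_le A l : (forall u v, A u -> A v -> `|u - v| <= l) ->
  (diam A <= l%:E)%E.
Proof.
move=> Al; apply: ge_ereal_sup => _ [[u v] /= [Au Av] <-].
by rewrite lee_fin Al.
Qed.

Lemma diam_ge0 A : A !=set0 -> (0 <= diam A)%E.
Proof.
by case=> u Au; apply: le_trans (diam_ge Au Au); rewrite subrr normr0.
Qed.

Lemma diam_fin_num A l : A !=set0 -> (diam A <= l%:E)%E ->
  diam A \is a fin_num.
Proof.
move=> /diam_ge0 A0 Al; rewrite ge0_fin_numE//.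
by apply: le_lt_trans Al _; exact: ltry.
Qed.

Lemma diam_pow_ge0 s A : (0 <= diam_pow s A)%E.
Proof. by rewrite /diam_pow; case: ifP => // _; exact: poweR_ge0. Qed.

(** For the empty set both sides are 0, because [fine] sends the diameter
    [-oo] to 0. *)
Lemma diam_pow_fine s A l : (diam A <= l%:E)%E -> s != 0 ->
  diam_pow s A = (fine (diam A) `^ s)%:E.
Proof.
move=> Al s0; rewrite /diam_pow; case: eqP => [->|/eqP/set0P A0].
  by rewrite diam_set0 powR0.
by rewrite -{1}(fineK (diam_fin_num A0 Al)) poweR_EFin.
Qed.

Lemma diam_pow_le s A l : 0 < s -> (diam A <= l%:E)%E -> 0 <= l ->
  (diam_pow s A <= (l `^ s)%:E)%E.
Proof.
move=> s0 Al l0; rewrite (diam_pow_fine Al) ?gt_eqF// lee_fin.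
have [->|A0] := eqVneq A set0.
  by rewrite diam_set0 /= powR0 ?gt_eqF// powR_ge0.
have /set0P {}A0 := A0.
apply: ge0_ler_powR; rewrite ?nnegrE//; first exact: ltW.
  by rewrite fine_ge0// diam_ge0.
by rewrite -lee_fin fineK// (diam_fin_num A0 Al).
Qed.

Lemma diam_pow_exponent s x A : 0 <= s <= x -> 0 < x -> (diam A <= 1)%E ->
  (diam_pow x A <= diam_pow s A)%E.
Proof.
move=> /andP[]; rewrite le_eqVlt => /predU1P[<- _|s0 sx] x0 A1.
  rewrite {2}/diam_pow; case: eqP => [->|_]; first by rewrite /diam_pow eqxx.
  rewrite poweRe0; apply: le_trans (diam_pow_le x0 A1 _) _ => //.
  by rewrite powR1.
rewrite !(diam_pow_fine A1) ?gt_eqF// lee_fin.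
have [->|A0] := eqVneq A set0.
  by rewrite diam_set0 /= !powR0 ?gt_eqF.
have /set0P {}A0 := A0.
have := fine_ge0 (diam_ge0 A0); rewrite le_eqVlt => /predU1P[<-|d0].
  by rewrite !powR0 ?gt_eqF.
apply: ger_powR => //; rewrite d0/= -lee_fin fineK//.
exact: (diam_fin_num A0 A1).
Qed.

End diameter.

Lemma powR_increment (R : realType) (x a e : R) : 0 < x -> 0 <= a -> 0 < e ->
  exists2 t, 0 < t & (a + t) `^ x = a `^ x + e.
Proof.
move=> x0 a0 e0; set y := (a `^ x + e) `^ x^-1.
have yx : y `^ x = a `^ x + e.
  by rewrite -powRrM mulVf ?gt_eqF// powRr1// addr_ge0 ?powR_ge0// ltW.
exists (y - a); last by rewrite addrC subrK.
rewrite subr_gt0 ltNge; apply/negP => ya.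
have : y `^ x <= a `^ x.
  by apply: ge0_ler_powR; rewrite ?nnegrE ?powR_ge0//; exact: ltW.
by rewrite yx; lra.
Qed.

Section self_similar_set.
Variables (R : realType) (f1 f2 : R -> R) (r1 r2 : R) (S : set R).
Hypotheses (r1_gt0 : 0 < r1) (r1_lt1 : r1 < 1).
Hypotheses (r2_gt0 : 0 < r2) (r2_lt1 : r2 < 1).
Hypothesis f1_dist : forall u v, `|f1 u - f1 v| = r1 * `|u - v|.
Hypothesis f2_dist : forall u v, `|f2 u - f2 v| = r2 * `|u - v|.
Hypothesis S_rec : S = f1 @` S `|` f2 @` S.
Hypothesis S_neq0 : S !=set0.
Hypothesis S_compact : compact S.

Lemma self_similar_f1 u : S u -> S (f1 u).
Proof. by move=> Su; rewrite S_rec; left; exists u. Qed.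

Lemma self_similar_f2 u : S u -> S (f2 u).
Proof. by move=> Su; rewrite S_rec; right; exists u. Qed.

Section lower_bound.
Variables (x d : R).
Hypotheses (x_gt0 : 0 < x) (d_gt0 : 0 < d).
Hypothesis r1r2x : r1 `^ x + r2 `^ x = 1.
Hypothesis f12_gap : forall u v, S u -> S v -> d <= `|f1 u - f2 v|.

(** Induction on the number of covering sets. Unless some covering set is as
    long as the gap, each of them meets at most one of the two pieces of [S].
    The cover then splits into covers of the two pieces with strictly fewer
    sets, which are pulled back to covers of [S] along the similarities. *)
Lemma finite_cover_sum_ge (J : seq nat) (U : nat -> set R) (l : nat -> R) :
  (forall j, 0 <= l j) ->
  (forall j u v, U j u -> U j v -> `|u - v| <= l j) ->
  (forall u, S u -> exists2 j, j \in J & U j u) ->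
  d `^ x <= \sum_(j <- J) l j `^ x.
Proof.
have [m] := ubnP (size J); elim: m J U l => // m IHm J U l.
rewrite ltnS => Jm l0 Ul SU.
have [[j Jj dj]|/forall2NP small] := pselect (exists2 j, j \in J & d <= l j).
  rewrite (big_rem _ Jj) /= -[leLHS]addr0 lerD//.
    by apply: ge0_ler_powR; rewrite ?nnegrE//; exact: ltW.
  by apply: sumr_ge0 => k _; exact: powR_ge0.
have {}small j : j \in J -> l j < d.
  by move=> Jj; have [//|/negP] := small j; rewrite -ltNge.
(* The indices of the sets that meet the first piece. *)
pose meets1 j := `[< exists2 u, S u & U j (f1 u) >].
rewrite (bigID meets1) /=.
have [u0 Su0] := S_neq0.
have [j1 Jj1 Uj1] := SU _ (self_similar_f1 Su0).
have [j2 Jj2 Uj2] := SU _ (self_similar_f2 Su0).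
have sep j u : j \in J -> S u -> U j (f2 u) -> ~~ meets1 j.
  move=> Jj Su Uju; apply/negP => /asboolP[v Sv Ujv].
  have := f12_gap Sv Su; have := Ul _ _ _ Ujv Uju; have := small _ Jj.
  by move=> ? ? ?; lra.
have bound (r : R) (f : R -> R) (p : pred nat) : 0 < r ->
    (forall u v, `|f u - f v| = r * `|u - v|) ->
    (size [seq j <- J | p j] < size J)%N ->
    (forall u, S u -> exists2 j, j \in J & p j /\ U j (f u)) ->
    r `^ x * d `^ x <= \sum_(j <- J | p j) l j `^ x.
  move=> r0 fr pJ fU.
  have := IHm [seq j <- J | p j] (fun j => f @^-1` U j) (fun j => l j / r).
  rewrite big_filter => /(_ (leq_trans pJ Jm)) h.
  have {}h : d `^ x <= \sum_(j <- J | p j) (l j / r) `^ x.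
    apply: h => [j|j u v /= Uu Uv|u Su].
    - by rewrite divr_ge0// ltW.
    - by rewrite ler_pdivlMr// mulrC -fr; exact: Ul Uu Uv.
    - by have [j Jj [pj Uj]] := fU _ Su; exists j; rewrite // mem_filter pj.
  apply: (@le_trans _ _ (r `^ x * \sum_(j <- J | p j) (l j / r) `^ x)).
    by rewrite ler_wpM2l// powR_ge0.
  rewrite mulr_sumr; apply: ler_sum => j _.
  rewrite -powRM ?divr_ge0 ?(ltW r0)//.
  by rewrite mulrCA divff ?gt_eqF// mulr1.
have szlt (p : pred nat) j : j \in J -> ~~ p j ->
    (size [seq j <- J | p j] < size J)%N.
  move=> Jj pj; rewrite size_filter -(count_predC p J) -[ltnLHS]addn0 ltn_add2l.
  by rewrite -has_count; apply/hasP; exists j.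
rewrite -[leLHS]mul1r -r1r2x mulrDl lerD//.
  apply: (bound _ f1) => //; first exact: (szlt _ j2 Jj2 (sep _ _ Jj2 Su0 Uj2)).
  move=> u Su; have [j Jj Uj] := SU _ (self_similar_f1 Su).
  by exists j => //; split=> //; apply/asboolP; exists u.
apply: (bound _ f2) => //.
  by apply: (szlt _ j1) => //; rewrite negbK; apply/asboolP; exists u0.
move=> u Su; have [j Jj Uj] := SU _ (self_similar_f2 Su).
by exists j => //; split=> //; exact: sep Uj.
Qed.

(** A countable cover is fattened to an open one at an arbitrarily small cost,
    and compactness leaves a finite one. *)
Lemma hausdorff_premeasure_ge : ((d `^ x)%:E <= hausdorff_premeasure x 1 S)%E.
Proof.
apply: le_ereal_inf_tmp => _ [U [SU U1] <-]; apply/lee_addgt0Pr => e e0.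
pose a n := fine (diam (U n)).
have a0 n : 0 <= a n.
  rewrite /a; have [->|/set0P Un] := eqVneq (U n) set0.
    by rewrite diam_set0.
  exact: fine_ge0 (diam_ge0 Un).
have e2 n : 0 < e / (2 ^ n.+1)%:R by rewrite divr_gt0// ltr0n expn_gt0.
pose t n := projT1 (cid2 (powR_increment x_gt0 (a0 n) (e2 n))).
have t0 n : 0 < t n by rewrite /t; case: cid2.
have tE n : (a n + t n) `^ x = a n `^ x + e / (2 ^ n.+1)%:R.
  by rewrite /t; case: cid2.
have Ua n u v : U n u -> U n v -> `|u - v| <= a n.
  move=> Uu Uv; rewrite -lee_fin fineK; first exact: diam_ge.
  by apply: (diam_fin_num _ (U1 n)); exists u.
pose V n := \bigcup_(u in U n) ball u (t n / 2).
have Vl n u v : V n u -> V n v -> `|u - v| <= a n + t n.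
  move=> [u' Uu' uu'] [v' Uv' vv']; have := Ua _ _ _ Uu' Uv'.
  move: uu' vv'; rewrite /ball /= => uu' vv' uv.
  have -> : u - v = - (u' - u) + (u' - v') + (v' - v) by lra.
  apply: le_trans (ler_normD _ _) _.
  apply: le_trans (lerD (ler_normD _ _) (lexx _)) _.
  by rewrite normrN; lra.
have Vopen n : open (V n).
  by apply: bigcup_open => u _; apply: ball_open; rewrite divr_gt0.
have SV : S `<=` cover setT V.
  move=> u /SU[n _ Uu]; exists n => //; exists u => //.
  by apply: ballxx; rewrite divr_gt0.
move: S_compact; rewrite compact_cover => /(_ _ setT V (fun i _ => Vopen i) SV).
move=> [D _ SD].
(* An initial segment of the indices contains the finite subcover. *)
pose N := \max_(j <- finmap.enum_fset D) j.+1.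
have cover_iota u : S u -> exists2 j, j \in index_iota 0 N & V j u.
  move=> /SD[j /= jD Vju]; exists j => //; rewrite mem_index_iota /=.
  exact: (@leq_bigmax_seq _ _ xpredT (fun j => j.+1)).
have := @finite_cover_sum_ge (index_iota 0 N) V (fun n => a n + t n) _
  Vl cover_iota.
under eq_bigr do rewrite tE.
rewrite -lee_fin => /(_ (fun n => addr_ge0 (a0 n) (ltW (t0 n)))) /le_trans.
apply.
apply: (@le_trans _ _
    (\sum_(0 <= n <oo) ((a n `^ x)%:E + (e / (2 ^ n.+1)%:R)%:E))%E).
  rewrite -sumEFin; under eq_bigr do rewrite EFinD.
  apply: (nneseries_lim_ge N) => n _ _.
  by rewrite -EFinD lee_fin addr_ge0 ?powR_ge0// ltW.
apply: le_trans (epsilon_trick xpredT _ (ltW e0)) _.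
  by move=> n; rewrite lee_fin powR_ge0.
rewrite leeD2r//; apply: lee_nneseries => [n _ _|n _].
  by rewrite lee_fin powR_ge0.
by rewrite (diam_pow_fine (U1 n)) ?gt_eqF.
Qed.

Lemma hausdorff_dim_ge : (x%:E <= hausdorff_dim S)%E.
Proof.
apply: le_ereal_inf_tmp => _ [s [s0 Hs] <-]; rewrite lee_fin leNgt.
apply/negP => sx; have : (0 < hausdorff_measure s S)%E; last by rewrite Hs ltxx.
apply: (@lt_le_trans _ _ (d `^ x)%:E); first by rewrite lte_fin powR_gt0.
apply: le_trans hausdorff_premeasure_ge _.
apply: (@le_trans _ _ (hausdorff_premeasure s 1 S)); last first.
  by apply: ereal_sup_ubound; exists 1 => /=.
apply: le_ereal_inf_tmp => _ [U [SU U1] <-].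
apply: (@le_trans _ _ (\sum_(0 <= n <oo) diam_pow x (U n))%E).
  by apply: ereal_inf_lbound; exists U.
apply: lee_nneseries => [n _ _|n _]; first exact: diam_pow_ge0.
by apply: diam_pow_exponent => //; rewrite s0 ltW.
Qed.

End lower_bound.

(** Iterating the decomposition [N] times covers the set by [2 ^ N] intervals,
    given by their centers and radii. *)
Lemma interval_cover : exists2 M : R, 0 < M & forall N, exists L : seq (R * R),
  [/\ forall u, S u -> exists2 c, c \in L & `|u - c.1| <= c.2,
      forall c, c \in L -> 0 <= c.2 <= Num.max r1 r2 ^+ N * M &
      forall s, \sum_(c <- L) c.2 `^ s = (r1 `^ s + r2 `^ s) ^+ N * M `^ s].
Proof.
have [M [Mreal SM]] := compact_bounded S_compact.
pose M' := Num.max 0 M + 1.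
have M'0 : 0 < M' by rewrite /M' ltr_wpDl// le_max lexx.
have MM' : M < M'.
  by rewrite /M' (@le_lt_trans _ _ (Num.max 0 M)) ?le_max ?lexx ?orbT// ltrDl.
exists M' => //; elim=> [|N [L [LS Lr Ls]]].
  exists [:: (0, M')]; split.
  - by move=> u Su; exists (0, M'); rewrite ?mem_head//= subr0; exact: SM Su.
  - by move=> c; rewrite inE => /eqP ->; rewrite expr0 mul1r ltW /=.
  - by move=> s; rewrite big_seq1 expr0 mul1r.
have r0 : 0 <= Num.max r1 r2 by rewrite le_max ltW.
pose h1 (c : R * R) := (f1 c.1, r1 * c.2).
pose h2 (c : R * R) := (f2 c.1, r2 * c.2).
exists (map h1 L ++ map h2 L); split.
- move=> u; rewrite S_rec => -[] [v Sv <-]; have [c cL vc] := LS _ Sv.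
    exists (h1 c); first by rewrite mem_cat map_f.
    by rewrite f1_dist ler_pM2l.
  exists (h2 c); first by rewrite mem_cat orbC map_f.
  by rewrite f2_dist ler_pM2l.
- move=> c; rewrite mem_cat => /orP[] /mapP[b bL ->] /=;
    have /andP[b0 bM] := Lr _ bL;
    rewrite mulr_ge0 ?(ltW r1_gt0) ?(ltW r2_gt0)//=;
    rewrite exprS -mulrA ler_pM// ?(ltW r1_gt0) ?(ltW r2_gt0)//;
    by rewrite le_max lexx ?orbT.
- move=> s; rewrite big_cat !big_map /= exprS -mulrA -Ls mulrDl !mulr_sumr.
  by congr (_ + _); apply: eq_big_seq => c cL; have /andP[? _] := Lr _ cL;
    rewrite powRM// ltW.
Qed.

Lemma small_interval_cover (s e : R) :
  0 < s -> r1 `^ s + r2 `^ s < 1 -> 0 < e ->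
  exists c l : nat -> R, [/\ forall n, 0 <= l n <= e,
    forall u, S u -> exists n, `|u - c n| <= l n &
    (\sum_(0 <= n <oo) (l n `^ s)%:E <= e%:E)%E].
Proof.
move=> s0 rho1 e0; have [M M0 cov] := interval_cover.
set rho := r1 `^ s + r2 `^ s in rho1.
have rho0 : 0 <= rho by rewrite addr_ge0 ?powR_ge0.
have r0 : 0 < Num.max r1 r2 by rewrite lt_max r1_gt0.
have rmax_lt1 : Num.max r1 r2 < 1 by rewrite gt_max r1_lt1.
have small (r m : R) : 0 <= r -> r < 1 -> 0 < m ->
    \forall n \near \oo, r ^+ n * m <= e.
  move=> rge0 rlt1 m0; have : (fun n => r ^+ n) @ \oo --> (0 : R).
    by apply: cvg_expr; rewrite ger0_norm.
  move=> /cvgr0_norm_le /(_ (e / m) (divr_gt0 e0 m0)); apply: filterS => n.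
  by rewrite ger0_norm ?exprn_ge0// ler_pdivlMr.
have [N [rN rhoN]] : exists N, Num.max r1 r2 ^+ N * M <= e /\
    rho ^+ N * M `^ s <= e.
  have := filterI (small _ _ (ltW r0) rmax_lt1 M0)
    (small _ _ rho0 rho1 (powR_gt0 s M0)).
  by move=> [N _ /(_ N (leqnn N))]; exists N.
have [L [LS Lr Ls]] := cov N.
(* Past the end of the list the intervals have radius 0. *)
pose b n := nth (0, 0) L n.
have b2 n : 0 <= (b n).2 <= e.
  have [nL|Ln] := ltnP n (size L); last by rewrite /b nth_default //= lexx ltW.
  have /andP[-> h] := Lr _ (mem_nth (0, 0) nL).
  exact: le_trans h rN.
exists (fun n => (b n).1), (fun n => (b n).2); split => //.
  move=> u /LS[c cL uc]; exists (index c L); rewrite /b nth_index//.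
rewrite (nneseries_split 0 (size L)); last first.
  by move=> k _; rewrite lee_fin powR_ge0.
rewrite add0n eseries0 ?adde0; last first.
  by move=> i Li _; rewrite /b nth_default//= powR0// gt_eqF.
rewrite sumEFin lee_fin -(big_nth (0,0) xpredT (fun c : R * R => c.2 `^ s)) Ls.
exact: rhoN.
Qed.

Lemma hausdorff_measure_self_similar0 s : 0 < s -> r1 `^ s + r2 `^ s < 1 ->
  hausdorff_measure s S = 0%E.
Proof.
move=> s0 rho1; apply/eqP; rewrite eq_le; apply/andP; split; last first.
  apply: le_ereal_sup_tmp; exists (hausdorff_premeasure s 1 S).
    by exists 1 => /=.
  apply: le_ereal_inf_tmp => _ [U _ <-]; apply: nneseries_ge0 => n _ _.
  exact: diam_pow_ge0.
apply: ge_ereal_sup => _ [e /= e0 <-]; apply/lee_addgt0Pr => t t0.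
rewrite add0e; have k0 : 0 < 2 `^ s :> R by rewrite powR_gt0.
pose m := Num.min (e / 2) (t / 2 `^ s).
have m0 : 0 < m by rewrite lt_min !divr_gt0.
have [c [l [lm cS suml]]] := small_interval_cover s0 rho1 m0.
pose U n := [set u : R | `|u - c n| <= l n].
have Ul n : (diam (U n) <= (2 * l n)%:E)%E.
  apply: diam_le => u v; rewrite /U /= => uc vc.
  have -> : u - v = (u - c n) - (v - c n) by lra.
  by apply: le_trans (ler_normB _ _) _; lra.
apply: (@le_trans _ _ (\sum_(0 <= n <oo) diam_pow s (U n))%E).
  apply: ereal_inf_lbound; exists U => //; split.
    by move=> u /cS[n un]; exists n.
  move=> n; apply: le_trans (Ul n) _; rewrite lee_fin.
  have /andP[_ h] := lm n; have : m <= e / 2 by rewrite ge_min lexx.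
  by lra.
apply: (@le_trans _ _ (\sum_(0 <= n <oo) (2 `^ s)%:E * (l n `^ s)%:E)%E).
  apply: lee_nneseries => [n _ _|n _]; first exact: diam_pow_ge0.
  have /andP[l0 _] := lm n.
  rewrite -EFinM -powRM//; apply: diam_pow_le => //.
  by rewrite mulr_ge0.
rewrite nneseriesZl; last by move=> n _; rewrite lee_fin powR_ge0.
apply: (@le_trans _ _ ((2 `^ s)%:E * m%:E)%E).
  by rewrite lee_wpmul2l// lee_fin ltW.
by rewrite -EFinM lee_fin mulrC -ler_pdivlMr// ge_min lexx orbT.
Qed.

Lemma lebesgue_measure_self_similar0 : r1 + r2 < 1 ->
  lebesgue_measure S = 0%E.
Proof.
move=> r12; apply/eqP; rewrite eq_le measure_ge0 andbT.
apply/lee_addgt0Pr => e e0; rewrite add0e.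
have h1 : r1 `^ 1 + r2 `^ 1 < 1 by rewrite !powRr1// ltW.
have e20 : 0 < e / 2 by rewrite divr_gt0.
have [c [l [lm cS suml]]] := small_interval_cover ltr01 h1 e20.
pose U n := `[c n - l n, c n + l n]%classic.
apply: (@le_trans _ _ (\sum_(0 <= n <oo) lebesgue_measure (U n))%E).
  apply: measure_sigma_subadditive.
  - by move=> n; exact: measurable_itv.
  - exact: compact_measurable.
  - move=> u /cS[n un]; exists n => //; rewrite /U /= in_itv /=.
    by move: un; rewrite ler_distl.
apply: (@le_trans _ _ (\sum_(0 <= n <oo) (2%:E * (l n `^ 1)%:E))%E).
  apply: lee_nneseries => // n _; have /andP[l0 _] := lm n.
  rewrite powRr1// /U lebesgue_measure_itv /= lte_fin.
  case: ifP => _; last by rewrite -EFinM lee_fin mulr_ge0.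
  by rewrite -EFinB -EFinM lee_fin; lra.
rewrite nneseriesZl; last by move=> n _; rewrite lee_fin powR_ge0.
apply: (@le_trans _ _ (2%:E * (e / 2)%:E)%E).
  by rewrite lee_wpmul2l// lee_fin.
by rewrite -EFinM lee_fin; lra.
Qed.

End self_similar_set.

Section Moran_equation.
Variables (R : realType) (r1 r2 : R).
Hypotheses (r1_gt0 : 0 < r1) (r1_lt1 : r1 < 1).
Hypotheses (r2_gt0 : 0 < r2) (r2_lt1 : r2 < 1).

Lemma gt_powR (r : R) : 0 < r < 1 -> {homo powR r : s t / s < t >-> t < s}.
Proof.
move=> /andP[r0 rlt1] s t st; rewrite /powR gt_eqF// ltr_expR.
by rewrite ltr_nM2r// ln_lt0// r0.
Qed.

Lemma Moran_sum_decreasing s t : s < t ->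
  r1 `^ t + r2 `^ t < r1 `^ s + r2 `^ s.
Proof. by move=> st; rewrite ltrD// gt_powR// ?r1_gt0 ?r2_gt0. Qed.

Lemma Moran_equation : r1 + r2 < 1 -> exists2 x, 0 < x < 1 &
  forall y, r1 `^ y + r2 `^ y = 1 <-> y = x.
Proof.
move=> r12.
have cont (r : R) : 0 < r -> continuous (powR r).
  move=> r0 y; have -> : powR r = @expR R \o (fun x => x * ln r).
    by apply/funext => x; rewrite /powR gt_eqF.
  apply: continuous_comp; last exact: continuous_expR.
  exact: cvgMr_tmp.
have phi_cont : {within `[0, 1], continuous (fun y => r1 `^ y + r2 `^ y)}.
  apply: continuous_subspaceT => y; apply: cvgD; exact: cont.
have [|x _ phix] := IVT (v := 1) ler01 phi_cont.
  rewrite !powRr0 !powRr1 ?(ltW r1_gt0) ?(ltW r2_gt0)//.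
  by rewrite ge_min le_max (ltW r12) orbT lerDl ler01.
have uniq y : r1 `^ y + r2 `^ y = 1 -> y = x.
  move=> phiy.
  have [/Moran_sum_decreasing|/Moran_sum_decreasing|//] := ltgtP y x;
  by rewrite phix phiy ltxx.
exists x; last by move=> y; split=> [/uniq|->].
apply/andP; split; rewrite ltNge le_eqVlt; apply/negP => /predU1P[x0|].
- by move: phix; rewrite x0 !powRr0 => h; lra.
- by move=> /Moran_sum_decreasing; rewrite phix !powRr0 => h; lra.
- by move: phix; rewrite -x0 !powRr1 ?ltW// => h; lra.
- by move=> /Moran_sum_decreasing; rewrite phix !powRr1 ?ltW// => h; lra.
Qed.

End Moran_equation.

(** The dimension of a separated self-similar set is the exponent at which the
    powers of the ratios sum to 1. *)
Lemma hausdorff_dim_self_similar (R : realType) (f1 f2 : R -> R)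
    (r1 r2 x d : R) (S : set R) :
  0 < r1 < 1 -> 0 < r2 < 1 ->
  (forall u v, `|f1 u - f1 v| = r1 * `|u - v|) ->
  (forall u v, `|f2 u - f2 v| = r2 * `|u - v|) ->
  S = f1 @` S `|` f2 @` S -> S !=set0 -> compact S ->
  0 < d -> (forall u v, S u -> S v -> d <= `|f1 u - f2 v|) ->
  0 < x -> r1 `^ x + r2 `^ x = 1 -> hausdorff_dim S = x%:E.
Proof.
move=> /andP[r10 r11] /andP[r20 r21] f1d f2d S_rec S0 Sc d0 gap x0 phix.
apply/eqP; rewrite eq_le; apply/andP; split; last first.
  exact: (hausdorff_dim_ge r10 r20 f1d f2d S_rec S0 Sc x0 d0 phix gap).
apply/lee_addgt0Pr => e e0; rewrite -EFinD; apply: ereal_inf_lbound.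
exists (x + e) => //=; split; first by rewrite addr_ge0// ltW.
apply: (hausdorff_measure_self_similar0 r10 r11 r20 r21 f1d f2d S_rec Sc).
  by rewrite addr_gt0.
rewrite -phix; apply: Moran_sum_decreasing => //.
by rewrite ltrDl.
Qed.

(** * Path probabilities of the Markov chain *)

Section markov_paths.
Variables (d : measure_display) (Omega : measurableType d) (R : realType).
Variables (P : probability Omega R) (X : nat -> {RV P >-> bool}).
Variables (p : bool -> R) (q : bool -> bool -> R).
Hypothesis hchain : markov_chain P X p q.

(** The event that the states of index 0 to [n], hence [n.+1] of them, are
    those of [a]. *)
Definition cylinder (a : nat -> bool) (n : nat) : set Omega :=
  [set w | forall k, (k <= n)%N -> X k w = a k].

(** The product formula for the probability of [cylinder a n]. *)
Definition path_prob (a : nat -> bool) (n : nat) : R :=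
  p (a 0%N) * \prod_(0 <= k < n) q (a k) (a k.+1).

Lemma cylinder0 a : cylinder a 0 = [set w | X 0%N w = a 0%N].
Proof.
apply/seteqP; split=> w /= h; first exact: h.
by move=> k; rewrite leqn0 => /eqP ->.
Qed.

Lemma cylinderS a n :
  cylinder a n.+1 = [set w | X n.+1 w = a n.+1] `&` cylinder a n.
Proof.
apply/seteqP; split=> w /=.
  by move=> h; split; [exact: h|move=> k kn; apply: h; exact: leqW].
by move=> [h1 h2] k; rewrite leq_eqVlt => /orP[/eqP ->//|]; exact: h2.
Qed.

Lemma measurable_state n b : measurable [set w | X n w = b].
Proof. exact: (measurable_funPTI (X n) (Y := [set b])). Qed.

Lemma measurable_cylinder a n : measurable (cylinder a n).
Proof.
elim: n => [|n IHn]; first by rewrite cylinder0; exact: measurable_state.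
by rewrite cylinderS; apply: measurableI => //; exact: measurable_state.
Qed.

(** When the past has probability 0 the transition law says nothing; both
    sides then vanish. *)
Lemma cylinderE a n : P (cylinder a n) = (path_prob a n)%:E.
Proof.
have [_ h0 hS] := hchain.
elim: n => [|n IHn]; first by rewrite cylinder0 h0 /path_prob big_geq// mulr1.
have mS b := measurable_state n.+1 b.
have mc := measurable_cylinder a n.
have [c0|] := ltP 0%E (P (cylinder a n)); last first.
  move=> c0; have {}c0 : P (cylinder a n) = 0%E.
    by apply/eqP; rewrite eq_le c0 measure_ge0.
  have pp0 : path_prob a n = 0 by move: IHn; rewrite c0 => -[].
  rewrite /path_prob big_nat_recr//= mulrA -/(path_prob a n) pp0 mul0r.
  apply/eqP; rewrite eq_le measure_ge0 andbT -[leRHS]/(0%E) -c0.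
  apply: le_measure.
  - by rewrite inE; exact: measurable_cylinder.
  - by rewrite inE.
  - by rewrite cylinderS; exact: subIsetr.
have := hS n a (a n.+1) c0.
rewrite /cond_prob -/(cylinder a n) -cylinderS IHn /=.
have pp0 : path_prob a n != 0 by move: c0; rewrite IHn lte_fin => /gt_eqF ->.
move=> /(canRL (divfK pp0)) h.
rewrite -[LHS]fineK; last by apply: fin_num_measure; exact: measurable_cylinder.
by rewrite h /path_prob big_nat_recr//= mulrA mulrC.
Qed.

Lemma path_prob_gt0 a n : 0 < p (a 0%N) ->
  (forall k, (k < n)%N -> 0 < q (a k) (a k.+1)) -> 0 < path_prob a n.
Proof.
move=> p0 q0; rewrite /path_prob mulr_gt0// big_mkord; apply: prodr_gt0 => k _.
exact: q0.
Qed.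

(** There are countably many finite histories, and each one that contains the
    impossible transition has probability 0. *)
Lemma impossible_transition_negligible (b c : bool) : q b c = 0 ->
  P.-negligible [set w | exists n, X n w = b /\ X n.+1 w = c].
Proof.
move=> qbc0.
pose F k := match unpickle k : option (seq bool * nat) with
  | Some (s, n) => if (nth false s n == b) && (nth false s n.+1 == c)
      then cylinder (nth false s) n.+1 else set0
  | None => set0
  end.
apply: (@negligibleS _ _ _ P (\bigcup_k F k)).
  move=> w [n [Xb Xc]]; exists (pickle (mkseq (fun k => X k w) n.+2, n)) => //.
  rewrite /F pickleK !nth_mkseq// Xb Xc !eqxx /= => k kn.
  by rewrite nth_mkseq.
apply: negligible_bigcup => k; rewrite /F.
case: unpickle => [[s n]|]; last exact: negligible_set0.
case: ifP => [/andP[/eqP sb /eqP sc]|_]; last exact: negligible_set0.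
apply/negligibleP; first exact: measurable_cylinder.
by rewrite [LHS]cylinderE /path_prob big_nat_recr//= sb sc qbc0 !mulr0.
Qed.

(** From the state [i] every transition has probability less than 1, and an
    admissible path is in state [i] at least once in any two steps. *)
Lemma admissible_path_negligible i a : (forall b, q i b < 1) ->
  admissible i a -> P.-negligible [set w | forall k, X k w = a k].
Proof.
have [[p_ge0 p_sum q_ge0 q_sum] _ _] := hchain; move=> qi1 adma.
have q_le1 b c : q b c <= 1.
  by have := q_sum b; have := q_ge0 b false; have := q_ge0 b true; case: c; lra.
have p_le1 b : p b <= 1.
  by have := p_sum; have := p_ge0 false; have := p_ge0 true; case: b; lra.
pose M := Num.max (q i false) (q i true).
have M0 : 0 <= M by rewrite le_max q_ge0.
have M1 : M < 1 by rewrite gt_max !qi1.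
have qM b : q i b <= M by rewrite le_max; case: b; rewrite lexx ?orbT.
have pp_ge0 n : 0 <= path_prob a n.
  by rewrite mulr_ge0// prodr_ge0.
have ppM n : path_prob a (n.*2) <= M ^+ n.
  elim: n => [|n IHn]; first by rewrite /path_prob big_geq// mulr1 expr0.
  rewrite doubleS /path_prob !big_nat_recr//= !mulrA -mulrA.
  rewrite -/(path_prob a _) exprSr.
  apply: ler_pM => //; first exact: mulr_ge0.
  have [->|->] := admissible_step n.*2 adma.
    by rewrite -[leRHS]mulr1 ler_pM.
  by rewrite -[leRHS]mul1r ler_pM.
have setE : [set w | forall k, X k w = a k] = \bigcap_n cylinder a n.
  apply/seteqP; split=> w /= h; first by move=> n _ k _.
  by move=> k; exact: (h k I k (leqnn k)).
apply/negligibleP.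
  by rewrite setE; apply: bigcapT_measurable => n; exact: measurable_cylinder.
apply/eqP; rewrite eq_le measure_ge0 andbT; apply/lee_addgt0Pr => e e0.
have : (fun n => M ^+ n) @ \oo --> (0 : R).
  by apply: cvg_expr; rewrite ger0_norm.
move=> /cvgr0_norm_le /(_ e e0) [N _ /(_ N (leqnn N))].
rewrite ger0_norm ?exprn_ge0// => MN; rewrite add0e.
apply: (@le_trans _ _ (P (cylinder a N.*2))).
  apply: le_measure; rewrite ?inE; last first.
  - by rewrite setE; exact: bigcap_inf.
  - exact: measurable_cylinder.
  - by rewrite setE; apply: bigcapT_measurable => n; exact: measurable_cylinder.
by rewrite [leLHS]cylinderE lee_fin (le_trans (ppM N)).
Qed.

Lemma le_probability_off_negligible (A B N : set Omega) :
  measurable A -> measurable B -> P.-negligible N ->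
  A `\` N `<=` B -> (P A <= P B)%E.
Proof.
move=> mA mB [N' [mN' N'0 NN']] ANB.
have AB : A `<=` B `|` N'.
  move=> w Aw; have [Nw|Nw] := pselect (N w); first by right; exact: NN'.
  by left; apply: ANB.
apply: (@le_trans _ _ (P (B `|` N'))).
  by apply: le_measure; rewrite ?inE//; exact: measurableU.
by apply: le_trans (measureU2 _ mB mN') _; rewrite [X in (_ + X)%E]N'0 adde0.
Qed.

End markov_paths.

(** * The distribution of the number with Markovian digits *)

Lemma unique_zero_gt0 (R : realType) (q : bool -> bool -> R) (a b : bool) :
  (forall c e, 0 <= q c e) ->
  #|[set ab : bool * bool | q ab.1 ab.2 == 0]%SET| = 1%N -> q a b = 0 ->
  forall c e, (c, e) <> (a, b) -> 0 < q c e.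
Proof.
move=> q_ge0 /eqP/cards1P[z /setP zE] qab c e ce.
rewrite lt_neqAle q_ge0 andbT eq_sym; apply/negP => qce.
have := zE (c, e); have := zE (a, b).
rewrite !finset.inE /= qab eqxx qce => /esym/eqP <- /esym/eqP; exact: ce.
Qed.

Section random_digits.
Variables (R : realType) (g0 : R).
Hypothesis hg0 : 2^-1 <= g0 < 1.
Variables (d : measure_display) (Omega : measurableType d).
Variables (P : probability Omega R) (X : nat -> {RV P >-> bool}).
Variables (p : bool -> R) (q : bool -> bool -> R) (tau : {RV P >-> R}).
Hypothesis hchain : markov_chain P X p q.
Hypothesis p_gt0 : forall a, 0 < p a.
Hypothesis htau : forall w, tau w = G2 g0 (fun n => X n w).
Hypothesis hq : #|[set ab : bool * bool | q ab.1 ab.2 == 0]%SET| = 1%N.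
Variable i : bool.

Let q_gt0 b c e : q (~~ i) b = 0 -> (c, e) <> (~~ i, b) -> 0 < q c e.
Proof.
have [[_ _ q_ge0 _] _ _] := hchain; move=> qb ce.
exact: (unique_zero_gt0 q_ge0 hq qb).
Qed.

Let q_row_lt1 b c : q (~~ i) b = 0 -> q i c < 1.
Proof.
have [[_ _ _ q_sum] _ _] := hchain; move=> qb; have := q_sum i.
have h e : 0 < q i e by apply: q_gt0 qb _ => -[]; case: (i).
by have := h false; have := h true; case: c; lra.
Qed.

Let measurable_tau (A : set R) : measurable A -> measurable (tau @^-1` A).
Proof. by move=> mA; exact: (measurable_funPTI tau). Qed.

Section absorbing.
Hypothesis absorbed : q (~~ i) i = 0.

(** The numbers whose digits are finitely many [i], possibly none, followed by
    [~~ i] forever. *)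
Definition absorbed_values : set R := range (fun k => G2 g0 (run_then k i)).

Lemma absorbed_valuesE : absorbed_values = [set G2 g0 (fun=> ~~ i)] `|`
  [set G2 g0 (run_then k i) | k in [set k | (1 <= k)%N]].
Proof.
apply/seteqP; split => x.
  by move=> [[|k] _ <-]; [left|right; exists k.+1].
by move=> [->|[k _ <-]]; [exists 0%N|exists k].
Qed.

Lemma countable_absorbed_values : countable absorbed_values.
Proof. exact: card_image_le. Qed.

Let escape : set Omega := [set w | exists n, X n w = ~~ i /\ X n.+1 w = i].

Let escape_negligible : P.-negligible escape.
Proof. exact: (impossible_transition_negligible hchain absorbed). Qed.

Lemma stays_absorbed w k n : ~ escape w ->
  X k w = ~~ i -> (k <= n)%N -> X n w = ~~ i.
Proof.
move=> Nw Xk; elim: n => [|n IHn]; first by rewrite leqn0 => /eqP <-.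
rewrite leq_eqVlt => /predU1P[<-//|kn].
apply: contra_notP Nw => Xn; exists n; split; first exact: IHn.
by case: (X n.+1 w) (i) Xn => -[].
Qed.

(** Almost surely the chain leaves [i] and never returns. *)
Lemma concentrated_absorbed :
  concentrated_on (distribution P tau) absorbed_values.
Proof.
have mA : measurable (~` absorbed_values).
  by apply: measurableC; apply: countable_measurable countable_absorbed_values.
rewrite /concentrated_on /distribution /pushforward.
apply: measure_negligible; first exact: measurable_tau.
apply: (@negligibleS _ _ _ P (escape `|` [set w | forall k, X k w = i])).
  move=> w; apply: contra_notP => /not_orP[Nw /existsNP[n /eqP Xn]] /=.
  have ex : exists n, X n w != i by exists n.
  have [k Xk kmin] := ex_minnP ex.
  exists k => //; rewrite htau; congr (G2 g0 _); apply/funext => m.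
  rewrite /run_then; case: ltnP => mk.
    by apply/esym/eqP/negPn/negP => /kmin; rewrite leqNgt mk.
  apply/esym; apply: stays_absorbed Nw _ mk.
  by case: (X k w) (i) Xk => -[].
apply: negligibleU; first exact: escape_negligible.
apply: (admissible_path_negligible hchain (a := fun=> i)) => [b|k].
  exact: q_row_lt1 absorbed.
by case: (i).
Qed.

(** Once [~~ i] is reached the whole path is determined, so the atom has at
    least the mass of the cylinder of its first [k.+1] digits. *)
Lemma atom_absorbed k : (0 < distribution P tau [set G2 g0 (run_then k i)])%E.
Proof.
apply: (@lt_le_trans _ _ (P (cylinder X (run_then k i) k))).
  rewrite (cylinderE hchain) lte_fin path_prob_gt0// => j jk.
  rewrite /run_then jk; apply: q_gt0 absorbed _ => -[].
  by case: (i).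
apply: le_probability_off_negligible escape_negligible _.
- exact: measurable_cylinder.
- exact: measurable_tau.
move=> w [/= Xw Nw]; rewrite htau; congr (G2 g0 _); apply/funext => n.
have [nk|kn] := leqP n k; first exact: Xw.
rewrite /run_then ltnNge (ltnW kn)/=; apply: stays_absorbed Nw _ (ltnW kn).
by rewrite Xw// /run_then ltnn.
Qed.

Lemma point_spectrum_absorbed :
  point_spectrum (distribution P tau) = absorbed_values.
Proof.
apply/seteqP; split=> [x|_ [k _ <-]]; last exact: atom_absorbed.
rewrite /point_spectrum/=; apply: contraPP => Ax; apply/negP; rewrite -leNgt.
rewrite -(concentrated_absorbed); apply: le_measure; rewrite ?inE//.
- by apply: measurableC; exact: countable_measurable countable_absorbed_values.
- by move=> w /= ->.
Qed.

Lemma absorbed_case : [/\ pure_discrete (distribution P tau),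
  (point_spectrum (distribution P tau) #= [set: nat])%card &
  point_spectrum (distribution P tau) = [set G2 g0 (fun=> ~~ i)] `|`
    [set G2 g0 (run_then k i) | k in [set k | (1 <= k)%N]]].
Proof.
split; last by rewrite -absorbed_valuesE point_spectrum_absorbed.
- exists absorbed_values; [exact: countable_absorbed_values|].
  exact: concentrated_absorbed.
- rewrite point_spectrum_absorbed; apply: inj_card_eq => j k _ _.
  exact: G2_run_then_inj.
Qed.

End absorbing.

Section no_repetition.
Hypothesis no_repeat : q (~~ i) (~~ i) = 0.

Let S := admissible_values g0 i.

Let S_closed : closed S.
Proof.
apply: compact_closed; first exact: Rhausdorff.
exact: compact_admissible_values.
Qed.

Let repeats : set Omega := [set w | exists n, X n w = ~~ i /\ X n.+1 w = ~~ i].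

Let repeats_negligible : P.-negligible repeats.
Proof. exact: (impossible_transition_negligible hchain no_repeat). Qed.

Let admissible_off_repeats w : ~ repeats w -> admissible i (X^~ w).
Proof. by move=> Nw k [Xk XSk]; apply: Nw; exists k. Qed.

Lemma concentrated_admissible : concentrated_on (distribution P tau) S.
Proof.
have mS : measurable (~` S) by apply: measurableC; exact: closed_measurable.
rewrite /concentrated_on /distribution /pushforward.
apply: measure_negligible; first exact: measurable_tau.
apply: negligibleS repeats_negligible => w; apply: contra_notP => Nw.
by exists (X^~ w); [exact: admissible_off_repeats|rewrite htau].
Qed.

(** A number has at most one admissible representation, so its mass is the
    probability of a single path. *)
Lemma no_atoms : point_spectrum (distribution P tau) = set0.
Proof.
apply/seteqP; split=> // x; apply/negP; rewrite -leNgt.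
have [[a adma ax]|Sx] := pselect (S x); last first.
  rewrite -[leRHS]/(0%E) -concentrated_admissible.
  apply: le_measure; rewrite ?inE//.
  - by apply: measurableC; exact: closed_measurable.
  - by move=> w /= ->.
rewrite [leLHS](_ : _ = 0%E)// /distribution /pushforward.
apply: measure_negligible; first exact: measurable_tau.
apply: (@negligibleS _ _ _ P (repeats `|` [set w | forall k, X k w = a k])).
  move=> w /= tx; have [?|Nw] := pselect (repeats w); [by left|right => k].
  have admX := admissible_off_repeats Nw.
  have -> // : a = X^~ w.
  by apply: (G2_inj hg0 (mem_set adma) (mem_set admX)); rewrite ax -tx htau.
apply: negligibleU; first exact: repeats_negligible.
apply: (admissible_path_negligible hchain) adma => b.
exact: q_row_lt1 no_repeat.
Qed.

(** Every neighbourhood of an admissible value contains the values of a whole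
    cylinder, which has positive probability. *)
Lemma spectrum_admissible : spectrum (distribution P tau) = S.
Proof.
apply/seteqP; split.
  by apply: bigcap_inf; split => //; exact: concentrated_admissible.
move=> _ [a adma <-] C [Ccl Cmu]; apply: contrapT => Ca.
have : nbhs (G2 g0 a) (~` C).
  by apply: open_nbhs_nbhs; split => //; exact: closed_openC.
move=> /nbhs_ballP[e /= e0 eC].
have : (fun n => g0 ^+ n) @ \oo --> (0 : R).
  by apply: cvg_expr; rewrite gtr0_norm ?(g0_gt0 hg0)// (g0_lt1 hg0).
have e20 : 0 < e / 2 by rewrite divr_gt0.
move=> /cvgr0_norm_le /(_ _ e20) [n _ /(_ n.+1 (leqnSn n))].
move=> /(le_trans (ler_norm _)) gn.
have mC : measurable (~` C) by apply: measurableC; exact: closed_measurable.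
have : (P (cylinder X a n) <= distribution P tau (~` C))%E.
  apply: le_measure; rewrite ?inE;
    [exact: measurable_cylinder|exact: measurable_tau|].
  move=> w /= Xw; apply: eC; rewrite /ball /= htau.
  apply: (@le_lt_trans _ _ (g0 ^+ n.+1)).
    by apply: (G2_close hg0) => k kn; rewrite Xw.
  by lra.
rewrite Cmu leNgt => /negP; apply.
rewrite (cylinderE hchain) lte_fin path_prob_gt0// => k _.
exact: q_gt0 no_repeat (adma k).
Qed.

End no_repetition.

End random_digits.

(** * Dimension and measure of the set of admissible values *)

Section dimension_of_admissible_values.
Variables (R : realType) (g0 : R).
Hypothesis hg0 : 2^-1 <= g0 < 1.
Variable i : bool.
Let S := admissible_values g0 i.
Let r1 := `|g g0 i|.
Let r2 := `|g g0 false * g g0 true|.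

Let r1_bounds : 0 < r1 < 1.
Proof. by rewrite /r1 normg_gt0// normg_lt1. Qed.

Let r2_bounds : 0 < r2 < 1.
Proof.
by rewrite /r2 normrM mulr_gt0 ?mulr_ilt1 ?(normg_gt0 hg0) ?(normg_lt1 hg0).
Qed.

Let r1r2 : r1 + r2 < 1.
Proof.
have := g0_gt0 hg0; have := g0_lt1 hg0.
rewrite /r1 /r2 normrM; case: (i);
by rewrite (normg_true hg0) (normg_false hg0); nra.
Qed.

Lemma dimension_admissible_values : exists x : R, [/\ 0 < x < 1,
  hausdorff_dim S = x%:E &
  forall y : R, r1 `^ y + r2 `^ y = 1 <-> y = x].
Proof.
have /andP[r10 r11] := r1_bounds; have /andP[r20 r21] := r2_bounds.
have [x x01 xP] := Moran_equation r10 r11 r20 r21 r1r2.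
exists x; split=> //.
apply: (@hausdorff_dim_self_similar R (prepend g0 i)
  (prepend g0 (~~ i) \o prepend g0 i) r1 r2 x ((1 - g0) ^+ 2 * g0 ^+ 3)).
- exact: r1_bounds.
- exact: r2_bounds.
- by move=> u v; exact: prepend_dist.
- by move=> u v; exact: prepend2_dist.
- exact: admissible_values_rec.
- by exists (G2 g0 (fun=> i)); exists (fun=> i) => // k; case: (i).
- exact: compact_admissible_values.
- exact: gap_gt0.
- move=> _ _ [a adma <-] [b admb <-].
  have -> : prepend g0 i (G2 g0 a) = G2 g0 (cons_digit i a).
    by rewrite (G2_rec hg0 (cons_digit i a)).
  have -> : (prepend g0 (~~ i) \o prepend g0 i) (G2 g0 b) =
      G2 g0 (cons_digit (~~ i) (cons_digit i b)).
    by rewrite (G2_rec hg0 (cons_digit _ _)) (G2_rec hg0 (shift _)).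
  apply: (G2_gap hg0 (admissible_cons_digit adma)); first by right.
  by rewrite /=; case: (i).
- by case/andP: x01.
- by apply/xP.
Qed.

Lemma lebesgue_admissible_values : lebesgue_measure S = 0%E.
Proof.
have /andP[r10 r11] := r1_bounds; have /andP[r20 r21] := r2_bounds.
apply: (@lebesgue_measure_self_similar0 R (prepend g0 i)
  (prepend g0 (~~ i) \o prepend g0 i) r1 r2) => //.
- by move=> u v; exact: prepend_dist.
- by move=> u v; exact: prepend2_dist.
- exact: admissible_values_rec.
- exact: compact_admissible_values.
Qed.

Lemma fractal_admissible_values : fractal S.
Proof.
have [x [/andP[x0 x1] dimx _]] := dimension_admissible_values.
exists x => //; apply/negP => /intrP[m xm].
move: x0 x1; rewrite xm ltr0z gtz0_ge1 ltrz1 => m1 /(le_lt_trans m1).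
by rewrite ltxx.
Qed.

End dimension_of_admissible_values.

Theorem theorem9 (R : realType) (g0 : R) (hg0 : 2^-1 <= g0 < 1)
  (d : measure_display) (Omega : measurableType d) (P : probability Omega R)
  (tau_ : nat -> {RV P >-> bool}) (p : bool -> R) (q : bool -> bool -> R)
  (hchain : markov_chain P tau_ p q)
  (hp : forall a, 0 < p a)
  (hq : #|[set ab : bool * bool | q ab.1 ab.2 == 0]%SET| = 1%N)
  (tau : {RV P >-> R}) (htau : forall w, tau w = G2 g0 (fun n => tau_ n w))
  (i : bool) :
  (q (~~ i) i = 0 ->
    [/\ pure_discrete (distribution P tau),
        (point_spectrum (distribution P tau) #= [set: nat])%card &
        point_spectrum (distribution P tau) =
          [set G2 g0 (fun=> ~~ i)] `|`
          [set G2 g0 (run_then k i) | k in [set k | (1 <= k)%N]]]) /\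
  (q (~~ i) (~~ i) = 0 ->
    let Stau := [set G2 g0 a | a in [set a : nat -> bool |
                forall k, (a k, a k.+1) <> (~~ i, ~~ i)]] in
    [/\ singularly_continuous (distribution P tau),
        cantor_type (distribution P tau),
        spectrum (distribution P tau) = Stau,
        self_similar g0 i Stau /\ fractal Stau &
        exists x : R, hausdorff_dim Stau = x%:E /\
          forall y : R,
            `|g g0 i| `^ y + `|g g0 false * g g0 true| `^ y = 1 <-> y = x]).
Proof.
split; first exact: (absorbed_case hg0 hchain hp htau hq).
move=> no_repeat Stau.
have conc : concentrated_on (distribution P tau) Stau.
  exact: (concentrated_admissible hg0 hchain htau no_repeat).
have specE : spectrum (distribution P tau) = Stau.
  exact: (spectrum_admissible hg0 hchain hp htau hq no_repeat).
split=> //.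
- split; first exact: (no_atoms hg0 hchain htau hq no_repeat).
  exists Stau; split=> //; last exact: lebesgue_admissible_values.
  by apply: compact_measurable; exact: compact_admissible_values.
- by rewrite /cantor_type specE; exact: lebesgue_admissible_values.
- split; first exact: self_similar_admissible_values.
  exact: fractal_admissible_values.
- have [x [_ dimx xP]] := dimension_admissible_values hg0 i.
  by exists x.
Qed.
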